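(* Let $(X,d)$ be a metric space and let $X'$ denote the set of all accumulation points of $X$. Then the following conditions are equivalent. (1) Every real valued ward continuous function defined on $X$ is uniformly continuous. (2) Every pseudo-Cauchy sequence with distinct terms in $X$ has a Bourbaki quasi-Cauchy subsequence in $X$. (3) Every sequence $(x_n)$ in $X$ satisfying $\lim_{n\to\infty}I(x_n)=0$ has a Bourbaki quasi-Cauchy subsequence in $X$. (4) $X'$ is Bourbaki quasi-precompact in $X$, and any infinite Bourbaki quasi-complete subset $U$ of $X$ disjoint from $X'$ is uniformly discrete. (5) $X'$ is Bourbaki quasi-precompact in $X$, and any infinite Bourbaki quasi-complete subset $U$ of $X$ disjoint from $X'$ satisfies $\inf\{I(x):x\in U\}>0$. (6) $X'$ is Bourbaki quasi-precompact in $X$, and every sequence $(x_n)$ of isolated points of $X$ without any Bourbaki quasi-Cauchy subsequence in $X$ satisfies $\inf\{I(x_n):n\in\mathbb{N}\}>0$. (7) Every discrete Bourbaki quasi-complete subset $A$ of $X$ is uniformly discrete. (8) Every Bourbaki quasi-complete subset $A$ of $X$ is a UC space.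
   Context: For $x\in X$, $I(x)=d(x,X\setminus\{x\})=\inf\{d(x,y):y\in X,\ y\ne x\}$ (infimum over the empty set being $+\infty$). A sequence $(x_n)$ in a metric space is quasi-Cauchy if for every $\varepsilon>0$ there is $n_0$ such that $d(x_{n+1},x_n)<\varepsilon$ for all $n\ge n_0$. A function between metric spaces is ward continuous if it maps quasi-Cauchy sequences to quasi-Cauchy sequences. A sequence $(x_n)$ is pseudo-Cauchy if for all $\varepsilon>0$ and all $n\in\mathbb{N}$ there are $j\ne k$ with $j,k>n$ and $d(x_j,x_k)<\varepsilon$. For $\varepsilon>0$ and $p\in X$, $B^\infty_\varepsilon(p)$ is the set of points $q\in X$ for which there are finitely many points $p=p_0,p_1,\dots,p_n=q$ in $X$ with $d(p_{i-1},p_i)<\varepsilon$ for $i=1,\dots,n$. A sequence $(x_n)$ is Bourbaki quasi-Cauchy in $X$ if for every $\varepsilon>0$ there exist $n_0\in\mathbb{N}$ and $p\in X$ such that $x_n\in B^\infty_\varepsilon(p)$ for every $n\ge n_0$. A set $B\subseteq X$ is Bourbaki quasi-precompact in $X$ if for every $\varepsilon>0$ there are finitely many $p_1,\dots,p_k\in X$ with $B\subseteq\bigcup_{i=1}^kB^\infty_\varepsilon(p_i)$. A set $A\subseteq X$ is a Bourbaki quasi-complete subset of $X$ if every sequence in $A$ which is Bourbaki quasi-Cauchy in $X$ (chains may pass through points of $X$) has a cluster point in $A$ (i.e. a subsequence converging to a point of $A$). A subset $A$ is discrete if its subspace topology is discrete, and uniformly discrete if there is $\delta>0$ with $d(x,y)\ge\delta$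 for all distinct $x,y\in A$. A metric space is a UC space if every real valued continuous function on it is uniformly continuous; a subset is UC if it is so with the induced metric. *)

(* Defs.v *)
From HB Require Import structures.
From mathcomp Require Import all_boot all_order all_algebra.
From mathcomp Require Import all_classical all_reals all_analysis.
Set Implicit Arguments.
Unset Strict Implicit.
Unset Printing Implicit Defensive.

Import Order.TTheory GRing.Theory Num.Theory.
Import numFieldNormedType.Exports.

Local Open Scope classical_set_scope.
Local Open Scope ring_scope.

(* The induced metric on a subset, on top of the pseudometric that the library
   already puts on [set_type A]. *)
Section subset_metric.
Context {R : realType} {X : metricType R} (A : set X).

Let dist (x y : A) : R := mdist (set_val x) (set_val y).

Let dist_ge0 x y : 0 <= dist x y.
Proof. exact: mdist_ge0. Qed.

Let dist_positivity x y : dist x y = 0 -> x = y.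
Proof. by move=> /mdist_positivity; exact: val_inj. Qed.

Let ballEdist (x : A) (r : R) : ball x r = [set y | dist x y < r].
Proof.
by rewrite -[LHS]/(set_val @^-1` ball (set_val x) r) ballEmdist.
Qed.

HB.instance Definition _ := @PseudoMetric_isMetric.Build R (set_type A)
  dist dist_ge0 dist_positivity ballEdist.

End subset_metric.

Section defs.
Context {R : realType}.

Definition quasi_cauchy (X : metricType R) (x : nat -> X) : Prop :=
  forall eps : R, 0 < eps -> \forall n \near \oo, mdist (x n.+1) (x n) < eps.

Definition ward_continuous (X Y : metricType R) (f : X -> Y) : Prop :=
  forall x : nat -> X, quasi_cauchy x -> quasi_cauchy (f \o x).

Definition UC_space (X : metricType R) : Prop :=
  forall f : X -> R^o, continuous f -> unif_continuous f.

Context {X : metricType R}.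
Implicit Types (x : nat -> X) (A : set X).

(* The infimum is taken in the extended reals, so that [isolation p = +oo]
   when [p] is the only point of [X]. *)
Definition isolation (p : X) : \bar R :=
  ereal_inf [set (mdist p q)%:E | q in [set q | q != p]].

Definition pseudo_cauchy x : Prop :=
  forall (eps : R) (n : nat), 0 < eps ->
    exists j k : nat, [/\ j != k, (n < j)%N, (n < k)%N & mdist (x j) (x k) < eps].

Definition chain_ball (eps : R) (p : X) : set X :=
  [set q | exists2 s : seq X, path (fun a b => mdist a b < eps) p s
                            & last p s = q].

Definition bourbaki_quasi_cauchy x : Prop :=
  forall eps : R, 0 < eps ->
    exists p : X, \forall n \near \oo, chain_ball eps p (x n).

Definition has_bqc_subsequence x : Prop :=
  exists2 phi : nat -> nat, increasing_seq phi & bourbaki_quasi_cauchy (x \o phi).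

Definition bourbaki_quasi_precompact A : Prop :=
  forall eps : R, 0 < eps ->
    exists2 F : set X, finite_set F & A `<=` \bigcup_(p in F) chain_ball eps p.

Definition bourbaki_quasi_complete A : Prop :=
  forall x, (forall n, A (x n)) -> bourbaki_quasi_cauchy x ->
    exists2 a : X, A a &
      exists2 phi : nat -> nat, increasing_seq phi & x \o phi @ \oo --> a.

Definition uniformly_discrete A : Prop :=
  exists2 delta : R, 0 < delta &
    forall p q, A p -> A q -> p != q -> delta <= mdist p q.

(* The condition defining the library's [discreteNbhsType], for the subspace
   topology of [A]. *)
Definition discrete_subset A : Prop :=
  @nbhs (set_type A) (set_type A) = principal_filter.

End defs.

(* Main.v *)
(* Every condition is compared with (3).

   If (3) fails for [x], then [x] has a subsequence whose terms lie in distinct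
   [eps]-chain components, for a single [eps]; together with close neighbours
   it gives pairs [x n != y n] with [mdist (x n) (y n)] tending to 0, one per
   component (so if the accumulation points are Bourbaki quasi-precompact, all
   but finitely many pairs avoid them).
   A Bourbaki quasi-Cauchy sequence is eventually in one [eps]-chain component,
   so the set of all [x n] and [y n] is discrete and Bourbaki quasi-complete but
   not uniformly discrete, and the function [mdist (x n) z / mdist (x n) (y n)]
   on the component of [x n], extended by [0], is ward continuous (it is
   Lipschitz on each component) but not uniformly continuous.

   Conversely, assume (3). Pairs [p n != q n] with [mdist (p n) (q n)] tending
   to 0 have Bourbaki quasi-Cauchy subsequences, hence a common cluster point in any
   Bourbaki quasi-complete set containing the [p n]. For (1), the steps from
   [p n] to [q n] and back are joined by finer and finer chains into one
   quasi-Cauchy sequence. *)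
Require Import Defs.
From mathcomp Require Import all_boot all_order all_algebra.
From mathcomp Require Import all_classical all_reals all_analysis.
Import Order.TTheory GRing.Theory Num.Theory.
Import numFieldNormedType.Exports.

Set Implicit Arguments.
Unset Strict Implicit.
Unset Printing Implicit Defensive.

Local Open Scope classical_set_scope.
Local Open Scope ring_scope.

(** * Dependent choice and extraction of subsequences *)

Lemma history_choice T (G : seq T -> T -> Prop) :
  (forall s, exists t, G s t) ->
  exists f : nat -> T, forall n, G (mkseq f n) (f n).
Proof.
(* [l n] lists the first [n] choices; each new one is computed from the list so far and appended to
   it. *)
move=> /choice[g Gg]; pose l n := iter n (fun s => rcons s (g s)) [::].
exists (g \o l) => n; suff -> : mkseq (g \o l) n = l n by exact: Gg.
by elim: n => // n IH; rewrite mkseqS IH.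
Qed.

(** The history forces each new index above all earlier ones, and it lets [P] compare the new index
    with them. *)
Lemma subsequence_history_choice (P : seq nat -> nat -> Prop) :
  (forall s N, exists2 m, (N < m)%N & P s m) ->
  exists2 phi : nat -> nat, increasing_seq phi &
    forall n, P (mkseq phi n) (phi n).
Proof.
move=> HP; have [s|phi phiP] := @history_choice nat
    (fun s m => (forall k, k \in s -> (k < m)%N) /\ P s m).
  have [m ltm Pm] := HP s (\max_(k <- s) k)%N.
  exists m; split=> // k ks; apply: leq_ltn_trans ltm.
  exact: (@leq_bigmax_seq _ s xpredT id k).
exists phi => [|n]; last by have [] := phiP n.
apply/increasing_seqP => n; rewrite ltEnat /=; apply: (phiP n.+1).1.
by apply: map_f; rewrite mem_iota add0n leqnn.
Qed.

Lemma subsequence_choice (P : nat -> nat -> Prop) :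
  (forall k N, exists2 m, (N < m)%N & P k m) ->
  exists2 phi : nat -> nat, increasing_seq phi & forall k, P k (phi k).
Proof.
move=> HP; have [s N|phi phi_incr phiP] :=
    @subsequence_history_choice (fun s m => P (size s) m); first exact: HP.
by exists phi => // k; have := phiP k; rewrite size_mkseq.
Qed.

Lemma leq_increasing_seq (phi : nat -> nat) n :
  increasing_seq phi -> (n <= phi n)%N.
Proof.
move=> /increasing_seqP phi_lt; elim: n => // n IH.
by apply: leq_ltn_trans IH _; have := phi_lt n; rewrite ltEnat.
Qed.

Lemma increasing_seq_comp (phi psi : nat -> nat) :
  increasing_seq phi -> increasing_seq psi -> increasing_seq (phi \o psi).
Proof. by move=> phiP psiP m n; rewrite phiP; exact: psiP. Qed.

Lemma near_increasing_seq (phi : nat -> nat) (P : nat -> Prop) :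
  increasing_seq phi -> (\forall n \near \oo, P n) ->
  \forall n \near \oo, P (phi n).
Proof.
move=> phi_incr [N _ NP]; exists N => // n /= Nn.
by apply: NP => /=; exact: leq_trans Nn (leq_increasing_seq _ phi_incr).
Qed.

Lemma exists_invSn_lt (R : realType) (e : R) :
  0 < e -> exists N, forall n, (N <= n)%N -> n.+1%:R^-1 < e.
Proof.
by move=> e0; have [N _ NP] := near_infty_natSinv_lt (PosNum e0); exists N.
Qed.

Lemma invSn_gt0 (R : realType) n : 0 < n.+1%:R^-1 :> R.
Proof. by rewrite invr_gt0 ltr0n. Qed.

(** * Chain components and Bourbaki quasi-Cauchy sequences *)

Section chains.
Context {R : realType} {X : metricType R}.
Implicit Types (x y : nat -> X) (p q : X) (eps : R).

Lemma chain_ball_refl eps p : chain_ball eps p p.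
Proof. by exists [::]. Qed.

Lemma chain_ball_step eps p q : mdist p q < eps -> chain_ball eps p q.
Proof. by move=> pq; exists [:: q] => //=; rewrite pq. Qed.

Lemma chain_ball_trans eps p q r :
  chain_ball eps p q -> chain_ball eps q r -> chain_ball eps p r.
Proof.
move=> [s ps <-] [t qt <-]; exists (s ++ t); last by rewrite last_cat.
by rewrite cat_path ps.
Qed.

Lemma chain_ball_sym eps p q : chain_ball eps p q -> chain_ball eps q p.
Proof.
move=> [s ps <-]; exists (rev (belast p s)); last first.
  by case: s {ps} => //= a s; rewrite rev_cons last_rcons.
rewrite rev_path; apply: sub_path ps => a b /=.
by rewrite metric_sym.
Qed.

Lemma le_chain_ball eps eps' p :
  eps <= eps' -> chain_ball eps p `<=` chain_ball eps' p.
Proof.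
move=> ee q [s ps <-]; exists s => //; apply: sub_path ps => a b /= ab.
exact: lt_le_trans ee.
Qed.

Lemma has_bqc_subsequence_subseq x (phi : nat -> nat) :
  increasing_seq phi -> has_bqc_subsequence (x \o phi) ->
  has_bqc_subsequence x.
Proof.
move=> phi_incr [psi psi_incr xC]; exists (phi \o psi) => //.
exact: increasing_seq_comp.
Qed.

(** A tail with steps below [eps] is itself an [eps]-chain starting at [x N]. *)
Lemma quasi_cauchy_bqc x : quasi_cauchy x -> bourbaki_quasi_cauchy x.
Proof.
move=> xC eps eps0; have [N _ xN] := xC _ eps0.
exists (x N); exists N => // n /= /subnKC <-.
elim: (n - N)%N => [|k IH]; first by rewrite addn0; exact: chain_ball_refl.
rewrite addnS; apply: chain_ball_trans IH (chain_ball_step _).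
by rewrite metric_sym; apply: xN => /=; exact: leq_addr.
Qed.

(* Along a free ultrafilter, either the sequence lies in one chain component
   for every [eps], or for some [eps] each chain component is visited on a
   negligible set of indices, so that a new component can always be found. *)
Lemma split_subsequence x : ~ has_bqc_subsequence x ->
  exists2 eps : R, 0 < eps & exists2 phi : nat -> nat, increasing_seq phi &
    forall m n, chain_ball eps (x (phi m)) (x (phi n)) -> m = n.
Proof.
move=> xC; have [U [UU sU]] := ultraFilterLemma eventually_filter.
have U_big (S : set nat) N : U S -> exists2 m, (N < m)%N & S m.
  move=> US; have UN : U [set m | (N < m)%N].
    by apply: sU; exists N.+1.
  by have [m [Sm Nm]] := filter_ex (filterI US UN); exists m.
have [allU|] := pselect (forall eps : R, 0 < eps ->
    exists p, U [set n | chain_ball eps p (x n)]).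
  exfalso; apply: xC.
  have /choice[c cP] (k : nat) : exists p : X,
      U [set n | chain_ball k.+1%:R^-1 p (x n)].
    by apply: allU; exact: invSn_gt0.
  (* Finite intersections stay in the ultrafilter, which makes a diagonal choice of indices
     possible. *)
  have UI k : U [set n | forall i, (i < k)%N ->
      chain_ball i.+1%:R^-1 (c i) (x n)].
    elim: k => [|k IH]; first by apply: sU; exists 0%N.
    apply: filterS (filterI IH (cP k)) => n [/= nk nck] i.
    by rewrite ltnS leq_eqVlt => /orP[/eqP ->|/nk].
  have [k N|phi phi_incr phiP] := @subsequence_choice
      (fun k n => forall i, (i < k)%N -> chain_ball i.+1%:R^-1 (c i) (x n)).
    exact: U_big (UI k).
  exists phi => // eps /exists_invSn_lt[N /(_ _ (leqnn _)) Ne].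
  (* [phiP n] concerns only the scales [i < n], hence the start at [N.+1]. *)
  exists (c N); exists N.+1 => // n /= Nn.
  by apply: (le_chain_ball (ltW Ne)); exact: phiP.
move=> /existsNP[eps /not_implyP[eps0 epsU]]; exists eps => //.
have UN (s : seq nat) :
    U [set n | forall k, k \in s -> ~ chain_ball eps (x k) (x n)].
  elim: s => [|k s IH]; first by apply: sU; exists 0%N.
  have [Uk|Uk] := in_ultra_setVsetC [set n | chain_ball eps (x k) (x n)] UU.
    by case: epsU; exists (x k).
  apply: filterS (filterI IH Uk) => n [/= ns nk] i.
  by rewrite inE => /orP[/eqP ->|/ns].
have [s N|phi phi_incr phiP] := @subsequence_history_choice
    (fun s n => forall k, k \in s -> ~ chain_ball eps (x k) (x n)).
  exact: U_big (UN s).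
exists phi => // m n.
wlog mn : m n / (m < n)%N => [wl mn|].
  by have [/wl->|/wl->|//] := ltngtP m n => //; exact: chain_ball_sym.
move=> /phiP[]; by apply: map_f; rewrite mem_iota add0n mn.
Qed.

End chains.

(** Path [n] leads from [x n] through [h n] to [x n.+1]. Keeping its first step apart from [t n]
    makes every path nonempty and lets [x n], [h n] be recovered as consecutive terms of [z]. The
    relations shrink as [n] grows, so all steps from path [n] on satisfy [e n]. *)
Lemma concatenate_paths (T : Type) (e : nat -> rel T) (x h : nat -> T)
    (t : nat -> seq T) :
  (forall m n, (m <= n)%N -> subrel (e n) (e m)) ->
  (forall n, path (e n) (x n) (h n :: t n)) ->
  (forall n, last (h n) (t n) = x n.+1) ->
  exists z : nat -> T,
    (forall n, \forall k \near \oo, e n (z k) (z k.+1)) /\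
    (forall n, exists2 k, (n <= k)%N & z k = x n /\ z k.+1 = h n).
Proof.
move=> e_anti pathP lastP.
(* In a state [(n, p, y, r)], [p] is the current point and [y :: r] is what
   remains of the path joining [x n] to [x n.+1]. *)
pose step (s : nat * T * T * seq T) : nat * T * T * seq T :=
  let: (n, p, y, r) := s in
  if r is y' :: r' then (n, y, y', r') else (n.+1, y, h n.+1, t n.+1).
pose state k := iter k step (0%N, x 0%N, h 0%N, t 0%N).
pose level k := (state k).1.1.1; pose z k := (state k).1.1.2.
have stateP k : path (e (level k)) (z k) ((state k).1.2 :: (state k).2) /\
    last (state k).1.2 (state k).2 = x (level k).+1.
  rewrite /level /z; elim: k => [|k].
    by split; [exact: pathP|exact: lastP].
  rewrite /state iterS -/(state k).
  case: (state k) => [[[n p] y] [|y' r]] /= [+ yx].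
    by move=> _; rewrite yx; split; [exact: pathP|exact: lastP].
  by case/andP.
have zS k : z k.+1 = (state k).1.2.
  rewrite /z /state iterS -/(state k).
  by case: (state k) => [[[n p] y] [|y' r]].
have levelS k : (level k <= level k.+1)%N.
  rewrite /level {2}/state iterS -/(state k).
  by case: (state k) => [[[n p] y] [|y' r]] /=.
have level_mono := homo_leq leqnn leq_trans levelS.
(* One step for each point of [r], and one more to load the next path. *)
have iter_step n p y r :
    iter (size r).+1 step (n, p, y, r) = (n.+1, last y r, h n.+1, t n.+1).
  by elim: r p y => // y' r IH p y; rewrite iterSr IH.
have reach n : exists2 k, (n <= k)%N & state k = (n, x n, h n, t n).
  elim: n => [|n [k nk sk]]; first by exists 0%N.
  exists ((size (t n)).+1 + k)%N.
    by rewrite addSn ltnS (leq_trans nk) ?leq_addl.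
  by rewrite /state iterD -/(state k) sk iter_step lastP.
exists z; split=> n; have [k nk sk] := reach n; last first.
  by exists k => //; rewrite zS /z sk.
exists k => // j /= kj; rewrite zS; apply: (e_anti n (level j)).
  by apply: leq_trans (level_mono _ _ kj); rewrite /level sk.
by have [/= /andP[]] := stateP j.
Qed.

(** * Uniform continuity, and ward continuity tested on close pairs *)

Section ward.
Context {R : realType} {X : metricType R}.

(** Two terms in the same [chain_ball] are joined through its centre, so the [k]-th index only has
    to lie in the tail belonging to the scale [k.+1%:R^-1]. *)
Lemma bqc_consecutive_chains (x : nat -> X) : bourbaki_quasi_cauchy x ->
  exists2 phi : nat -> nat, increasing_seq phi &
    forall k, chain_ball k.+1%:R^-1 (x (phi k)) (x (phi k.+1)).
Proof.
move=> xC; have [k N|phi phi_incr phiP] := @subsequence_choice (fun k n =>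
    forall m, (n <= m)%N -> chain_ball k.+1%:R^-1 (x n) (x m)).
  have [p [M _ xp]] := xC _ (invSn_gt0 R k).
  exists (maxn N.+1 M); first exact: leq_maxl.
  move=> m le_m; apply: (@chain_ball_trans _ _ _ _ p).
    by apply: chain_ball_sym; apply: xp => /=; exact: leq_maxr.
  by apply: xp => /=; apply: leq_trans le_m; exact: leq_maxr.
exists phi => // k; apply: phiP.
by have : (phi k <= phi k.+1)%O by rewrite phi_incr.
Qed.

Lemma unif_continuous_mdistP (Y : metricType R) (f : X -> Y) :
  unif_continuous f <-> forall eps : R, 0 < eps ->
    exists2 delta : R, 0 < delta & forall p q, mdist p q < delta -> mdist (f p) (f q) < eps.
Proof.
split=> [fU eps eps0|fU].
  have : entourage [set yy : Y * Y | ball yy.1 eps yy.2].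
    by rewrite -entourage_ballE; exists eps.
  move=> /fU; rewrite /nbhs/= -entourage_ballE => -[d /= d0 dP].
  exists d => // p q pq; have := dP (p, q).
  by rewrite /= !ballEmdist; apply.
move=> A; rewrite -entourage_ballE => -[eps /= eps0 epsA].
have [d d0 dP] := fU _ eps0.
rewrite /nbhs/= -entourage_ballE; exists d => //= -[p q] /=.
by rewrite ballEmdist => /dP pq; apply: epsA => /=; rewrite ballEmdist.
Qed.

Lemma not_unif_continuous_pairs (Y : metricType R) (f : X -> Y) :
  ~ unif_continuous f -> exists2 eps : R, 0 < eps & exists p q : nat -> X,
    forall n, mdist (p n) (q n) < n.+1%:R^-1 /\
      eps <= mdist (f (p n)) (f (q n)).
Proof.
move=> /unif_continuous_mdistP/existsNP[eps /not_implyP[eps0 fU]].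
exists eps => //; suff /choice[pq pqP] (n : nat) : exists pq : X * X,
    mdist pq.1 pq.2 < n.+1%:R^-1 /\ eps <= mdist (f pq.1) (f pq.2).
  by exists (fst \o pq), (snd \o pq).
apply: contrapT => no_pq; apply: fU; exists n.+1%:R^-1; first exact: invSn_gt0.
move=> p q pq; rewrite ltNge; apply/negP => fpq.
by apply: no_pq; exists (p, q).
Qed.

(* The values [p n], [q n], [p n] are inserted into chains joining successive
   terms of a subsequence of [p]. *)
Lemma ward_continuous_pairs (Y : metricType R) (f : X -> Y) (p q : nat -> X)
    (eps : R) :
  ward_continuous f -> 0 < eps -> bourbaki_quasi_cauchy p ->
  (forall n, mdist (p n) (q n) < n.+1%:R^-1) ->
  exists n, mdist (f (p n)) (f (q n)) < eps.
Proof.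
move=> fW eps0 /bqc_consecutive_chains[phi phi_incr phi_chain] pq.
have /choice[s sP] (k : nat) : exists s : seq X,
    path (fun a b => mdist a b < k.+1%:R^-1) (p (phi k)) s /\
    last (p (phi k)) s = p (phi k.+1).
  by have [s ps ls] := phi_chain k; exists s.
have [||k|z [zC zP]] := @concatenate_paths X
    (fun k a b => mdist a b < k.+1%:R^-1)
    (p \o phi) (q \o phi) (fun k => p (phi k) :: s k).
- move=> m n mn a b /= ab; apply: lt_le_trans ab _.
  by rewrite lef_pV2 ?posrE ?ltr0n// ler_nat ltnS.
- move=> k; have pqk : mdist (p (phi k)) (q (phi k)) < k.+1%:R^-1.
    apply: lt_le_trans (pq _) _.
    by rewrite lef_pV2 ?posrE ?ltr0n// ler_nat ltnS leq_increasing_seq.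
  by rewrite /= (metric_sym (q _)) pqk; exact: (sP k).1.
- exact: (sP k).2.
have /fW/(_ _ eps0)[N _ NP] : quasi_cauchy z.
  move=> e /exists_invSn_lt[N /(_ _ (leqnn _)) Ne].
  have [K _ KP] := zC N; exists K => // k Kk; rewrite metric_sym.
  exact: lt_trans (KP _ Kk) Ne.
(* The excursion of index [N] occurs at a position [k >= N], where the tail bound on [f \o z]
   holds. *)
have [k Nk [zk zSk]] := zP N; exists (phi N).
by have := NP k Nk; rewrite /= zk zSk metric_sym.
Qed.

End ward.

(** * Isolation, accumulation points and discreteness in terms of distances *)

Section isolation.
Context {R : realType} {X : metricType R}.
Implicit Types (p q : X) (e : R).

Lemma isolation_ltP p e :
  (isolation p < e%:E)%E <-> exists2 q, q != p & mdist p q < e.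
Proof.
split=> [/ereal_inf_ltP[_ [q qp <-]]|[q qp pq]].
  by rewrite lte_fin; exists q.
by apply/ereal_inf_ltP; exists (mdist p q)%:E; [exists q|rewrite lte_fin].
Qed.

Lemma isolation_ge0 p : (0 <= isolation p)%E.
Proof. by apply: le_ereal_inf_tmp => _ [q _ <-]; rewrite lee_fin mdist_ge0. Qed.

Lemma isolation_cvg0P (x : nat -> X) :
  isolation (x n) @[n --> \oo] --> 0%E <-> forall e, 0 < e ->
    \forall n \near \oo, exists2 q, q != x n & mdist (x n) q < e.
Proof.
split=> [/fine_cvgP[xfin /cvgrPdist_lt xc] e e0|xe].
  near=> n; apply/isolation_ltP.
  have xn : isolation (x n) \is a fin_num by near: n.
  rewrite -(fineK xn) lte_fin; apply: le_lt_trans (ler_norm _) _.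
  by rewrite -normrN -sub0r; near: n; exact: xc.
apply/fine_cvgP; split.
  (* A neighbour at distance below 1 already makes the isolation finite. *)
  have [N _ NP] := xe _ ltr01; exists N => // n /NP /isolation_ltP xn.
  by rewrite ge0_fin_numE ?isolation_ge0// (lt_trans xn) ?ltry.
apply/cvgrPdist_lt => e e0; have [N _ NP] := xe _ e0.
exists N => // n /NP /isolation_ltP xn; rewrite sub0r normrN ger0_norm.
  by rewrite -lte_fin fineK// ge0_fin_numE ?isolation_ge0// (lt_trans xn) ?ltry.
by rewrite fine_ge0 ?isolation_ge0.
Unshelve. all: by end_near. Qed.

Lemma isolation_cvg0 (x y : nat -> X) : (forall n, x n != y n) ->
  (forall n, mdist (x n) (y n) < n.+1%:R^-1) ->
  isolation (x n) @[n --> \oo] --> 0%E.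
Proof.
move=> xy dxy; apply/isolation_cvg0P => e /exists_invSn_lt[N Ne].
exists N => // n Nn; exists (y n); first by rewrite eq_sym.
exact: lt_trans (Ne _ Nn).
Qed.

Lemma inf_isolation_gt0P T (D : set T) (x : T -> X) :
  (0 < ereal_inf [set isolation (x t) | t in D])%E <-> exists2 e, 0 < e &
    forall t q, D t -> q != x t -> e <= mdist (x t) q.
Proof.
split=> [inf0|[e e0 eP]]; last first.
  apply: (@lt_le_trans _ _ e%:E); first by rewrite lte_fin.
  apply: le_ereal_inf_tmp => _ [t Dt <-].
  by apply: le_ereal_inf_tmp => _ [q qx <-]; rewrite lee_fin; exact: eP.
have [e e0 ele] : exists2 e : R, 0 < e &
    (e%:E <= ereal_inf [set isolation (x t) | t in D])%E.
  case: ereal_inf inf0 => [r||] //=; rewrite ?lte_fin => r0; first by exists r.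
  (* Here the infimum is [+oo], so any positive real would do. *)
  by exists 1 => //; rewrite leey.
exists e => // t q Dt qx; rewrite leNgt; apply/negP => xq.
have /isolation_ltP : exists2 q, q != x t & mdist (x t) q < e by exists q.
by rewrite ltNge (le_trans ele)//; apply: ereal_inf_lbound; exists t.
Qed.

Lemma limit_point_setTP p : limit_point [set: X] p <->
  forall e, 0 < e -> exists2 q, q != p & mdist p q < e.
Proof.
split=> [pX e e0|pX U].
  have [|q [qp _ pq]] := pX (ball p e); first exact: nbhsx_ballx.
  by exists q => //; move: pq; rewrite ballEmdist.
rewrite -nbhs_ballE => -[e /= e0 eU]; have [q qp pq] := pX _ e0.
by exists q; split=> //; apply: eU; rewrite ballEmdist.
Qed.

Lemma not_limit_point_setTP p : ~ limit_point [set: X] p <->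
  exists2 e, 0 < e & forall q, mdist p q < e -> q = p.
Proof.
rewrite limit_point_setTP.
split=> [/existsNP[e /not_implyP[e0 pe]]|[e e0 pe] pX].
  exists e => // q pq; apply/eqP; apply: contra_notT pe => qp; by exists q.
by have [q /eqP qp /pe] := pX _ e0.
Qed.

Lemma isolated_setTP p : isolated [set: X] p <-> ~ limit_point [set: X] p.
Proof.
split=> [[_ [V Vp VI]] pX|/not_limit_point_setTP[e e0 pe]].
  have [q [/eqP qp _ Vq]] := pX V Vp; apply: qp.
  by have : (V `&` [set: X]) q by []; rewrite VI.
split; first by rewrite inE.
exists (ball p e); first exact: nbhsx_ballx.
rewrite setIT ballEmdist; apply/seteqP; split=> q /=; first exact: pe.
by move=> ->; rewrite mdistxx.
Qed.

Lemma discrete_subsetP (A : set X) : discrete_subset A <->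
  forall p, A p -> exists2 e, 0 < e & forall q, A q -> mdist p q < e -> q = p.
Proof.
split=> [Adisc p Ap|Adisc].
  pose a : set_type A := exist _ p (mem_set Ap).
  have : nbhs a [set a] by rewrite Adisc.
  rewrite -nbhs_ballE => -[e /= e0 ea]; exists e => // q Aq pq.
  have := ea (exist _ q (mem_set Aq)); rewrite ballEmdist => /(_ pq).
  by move=> /(congr1 (@set_val _ A)).
apply/funext => a; apply/seteqP; split=> U.
  by move=> /nbhs_singleton/principal_filterP.
move=> /principal_filterP Ua; have [e e0 ae] := Adisc _ (set_valP a).
apply/nbhs_ballP; exists e => // b; rewrite ballEmdist => /(ae _ (set_valP b)).
by move=> ba; have -> : b = a by exact: val_inj.
Qed.

End isolation.

Lemma mdist_regular (R : realType) (a b : R^o) : mdist a b = `|b - a|.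
Proof. by []. Qed.

(** * Close pairs in distinct chain components, and the counterexamples built on them *)

Section split_pairs.
Context {R : realType} {X : metricType R}.
Implicit Types (x y : nat -> X) (eps : R).

(** The bound by [eps] puts [y n] in the [eps]-chain component of [x n]; the last clause says that
    these components are distinct for distinct [n]. *)
Definition split_pairs eps x y : Prop :=
  [/\ 0 < eps, forall n, x n != y n, forall n, mdist (x n) (y n) < n.+1%:R^-1,
      forall n, mdist (x n) (y n) < eps &
      forall m n, chain_ball eps (x m) (x n) -> m = n].

Lemma split_pairs_exist x : isolation (x n) @[n --> \oo] --> 0%E ->
  ~ has_bqc_subsequence x -> exists eps x' y, split_pairs eps x' y.
Proof.
move=> /isolation_cvg0P x0 /split_subsequence[eps eps0 [phi phi_incr phiP]].
have /choice[psi psiP] (k : nat) : exists mq : nat * X,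
    [/\ (k <= mq.1)%N, x (phi mq.1) != mq.2,
        mdist (x (phi mq.1)) mq.2 < k.+1%:R^-1 &
        mdist (x (phi mq.1)) mq.2 < eps].
  have e0 : 0 < Num.min eps k.+1%:R^-1 by rewrite lt_min eps0 invSn_gt0.
  have [N _ NP] := near_increasing_seq phi_incr (x0 _ e0).
  have [q qx] := NP _ (leq_maxr k N); rewrite lt_min => /andP[qe qk].
  by exists (maxn k N, q); split; rewrite //= ?leq_maxl 1?eq_sym.
(* The indices [(psi k).1] may repeat; [chi] makes them strictly increasing, and [size s <= k]
   preserves the bound on the distances. *)
have [s N|chi chi_incr chiP] :=
    @subsequence_history_choice (fun s k => (size s <= k)%N /\
      forall j, j \in s -> ((psi j).1 < (psi k).1)%N).
  (* Since [(psi M).1] is at least [M], a large [M] takes the new index past all earlier ones. *)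
  pose M := maxn N.+1 (maxn (size s) (\max_(j <- s) (psi j).1).+1).
  exists M; first by rewrite leq_max leqnn.
  split=> [|j js]; first by rewrite !leq_max leqnn orbT.
  apply: (@leq_ltn_trans (\max_(j <- s) (psi j).1)).
    exact: (@leq_bigmax_seq _ s xpredT (fun j => (psi j).1) j).
  have [Mpsi _ _ _] := psiP M; apply: leq_trans Mpsi.
  by rewrite !leq_max leqnn !orbT.
have le_chi k : (k <= chi k)%N by have [+ _] := chiP k; rewrite size_mkseq.
exists eps, (fun k => x (phi (psi (chi k)).1)), (fun k => (psi (chi k)).2).
split=> // [k|k|k|m n /phiP mn]; try by have [] := psiP (chi k).
  have [_ _ + _] := psiP (chi k) => /lt_le_trans; apply.
  by rewrite lef_pV2 ?posrE ?ltr0n// ler_nat ltnS.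
have lt_psi i j : (i < j)%N -> ((psi (chi i)).1 < (psi (chi j)).1)%N.
  move=> ij; apply: (chiP j).2; apply: map_f.
  by rewrite mem_iota add0n ij.
by have [/lt_psi|/lt_psi|//] := ltngtP m n; rewrite mn ltnn.
Qed.

Lemma split_pairs_shift eps x y N : split_pairs eps x y ->
  split_pairs eps (fun n => x (N + n)%N) (fun n => y (N + n)%N).
Proof.
move=> [eps0 xy dxy xye xP]; split=> // [n|m n /xP/addnI//].
apply: lt_le_trans (dxy _) _.
by rewrite lef_pV2 ?posrE ?ltr0n// ler_nat ltnS leq_addl.
Qed.

Definition pair_set x y : set X := [set p | exists n, p = x n \/ p = y n].

Section theory.
Variables (eps : R) (x y : nat -> X).
Hypothesis sxy : split_pairs eps x y.

Let eps0 : 0 < eps. Proof. by case: sxy. Qed.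

Lemma split_pairs_neq n : x n != y n.
Proof. by case: sxy. Qed.

Lemma split_pairs_mdist n : mdist (x n) (y n) < n.+1%:R^-1.
Proof. by case: sxy. Qed.

Lemma split_pairs_inj m n : chain_ball eps (x m) (x n) -> m = n.
Proof. by case: sxy => _ _ _ _; apply. Qed.

Lemma split_pairs_chain n : chain_ball eps (x n) (y n).
Proof. by apply: chain_ball_step; case: sxy. Qed.

Let chain_pair n (z : X) : z = x n \/ z = y n -> chain_ball eps (x n) z.
Proof.
by move=> [->|->]; [exact: chain_ball_refl|exact: split_pairs_chain].
Qed.

(** Each [z n] lies in the component of [x (k n)], and a tail of [z] lies in a single component. *)
Lemma split_pairs_bqc (k : nat -> nat) (z : nat -> X) :
  (forall n, z n = x (k n) \/ z n = y (k n)) -> bourbaki_quasi_cauchy z ->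
  exists K, \forall n \near \oo, k n = K.
Proof.
move=> zP /(_ _ eps0)[p [N _ NP]].
have pk n : (N <= n)%N -> chain_ball eps p (x (k n)).
  move=> /NP pz; apply: chain_ball_trans pz (chain_ball_sym _).
  exact: chain_pair.
exists (k N); exists N => // n /= Nn; apply: split_pairs_inj.
exact: chain_ball_trans (chain_ball_sym (pk n Nn)) (pk N (leqnn N)).
Qed.

Lemma split_pairs_no_bqc : ~ has_bqc_subsequence x.
Proof.
move=> [phi phi_incr /(@split_pairs_bqc phi)[n|K [N _ NP]]]; first by left.
have := leq_increasing_seq (maxn N K.+1) phi_incr.
by rewrite NP /= ?leq_maxl// leqNgt leq_max leqnn orbT.
Qed.

Lemma pair_setl n : pair_set x y (x n). Proof. by exists n; left. Qed.

Lemma pair_setr n : pair_set x y (y n). Proof. by exists n; right. Qed.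

Lemma pair_set_infinite : infinite_set (pair_set x y).
Proof.
apply: (@sub_infinite_set _ (range x)) => [_ [n _ <-]|]; first exact: pair_setl.
suff xinj : injective x.
  have xinjT : {in [set: nat] &, injective x} by exact: in2W.
  by apply/infiniteP; have /card_eqPle[] := inj_card_eq xinjT.
by move=> m n xmn; apply: split_pairs_inj; rewrite xmn; exact: chain_ball_refl.
Qed.

(** A Bourbaki quasi-Cauchy sequence in this set eventually takes only the values [x K] and [y K];
    one of them recurs infinitely often and gives a constant subsequence. *)
Lemma pair_set_bqc : bourbaki_quasi_complete (pair_set x y).
Proof.
move=> z /choice[k kP] zC; have [K [N _ NP]] := split_pairs_bqc kP zC.
have [a Aa az] : exists2 a, pair_set x y a &
    forall M, exists2 m, (M < m)%N & z m = a.
  have [zx|] := pselect (forall M, exists2 m, (M < m)%N & z m = x K).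
    by exists (x K) => //; exact: pair_setl.
  move=> /existsNP[L zx]; exists (y K); first exact: pair_setr.
  move=> M; exists (maxn N (maxn M L).+1).
    by rewrite leq_max ltnS leq_maxl orbT.
  set m := maxn _ _; have [//|] := kP m; rewrite NP /= ?leq_maxl// => zm.
  by case: zx; exists m => //; rewrite leq_max ltnS leq_maxr orbT.
have [_|phi phi_incr phiP] := @subsequence_choice (fun _ m => z m = a) => //.
exists a => //; exists phi => //.
have -> : z \o phi = fun=> a by apply/funext => n /=.
exact: cvg_cst.
Qed.

Lemma pair_set_not_uniformly_discrete : ~ uniformly_discrete (pair_set x y).
Proof.
move=> [d d0 dP]; have [N /(_ _ (leqnn _)) Nd] := exists_invSn_lt d0.
have := dP _ _ (pair_setl N) (pair_setr N) (split_pairs_neq N).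
by rewrite leNgt (lt_trans (split_pairs_mdist N)).
Qed.

Lemma pair_set_discrete : discrete_subset (pair_set x y).
Proof.
apply/discrete_subsetP => p [n pn].
(* The bound [eps] confines [q] to the pair of [p]; the distance within the pair excludes the other
   member. *)
exists (Num.min eps (mdist (x n) (y n))).
  by rewrite lt_min eps0 mdist_gt0 split_pairs_neq.
move=> q [m qm]; rewrite lt_min => /andP[/chain_ball_step pq].
have mn : n = m.
  apply: split_pairs_inj; apply: chain_ball_trans (chain_pair pn) _.
  apply: chain_ball_trans pq (chain_ball_sym _); exact: chain_pair.
case: pn qm => -> [->|->]; rewrite -mn//.
  by rewrite ltxx.
by rewrite metric_sym ltxx.
Qed.

Lemma split_pairs_function : exists f : X -> R^o,
  [/\ ward_continuous f, continuous f, forall n, f (x n) = 0 &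
      forall n, f (y n) = 1].
Proof.
(* The second clause fixes the value 0 on components that contain no [x n]. *)
have /choice[f fP] (z : X) : exists v : R,
    (forall n, chain_ball eps (x n) z ->
      v = mdist (x n) z / mdist (x n) (y n)) /\
    ((forall n, ~ chain_ball eps (x n) z) -> v = 0).
  have [[n nz]|nz] := pselect (exists n, chain_ball eps (x n) z); last first.
    by exists 0; split=> // n nz'; case: nz; exists n.
  exists (mdist (x n) z / mdist (x n) (y n)); split=> [m mz|/(_ n)//].
  have -> // : m = n.
  exact: split_pairs_inj (chain_ball_trans mz (chain_ball_sym nz)).
(* The Lipschitz constant depends on the component of [z]; it grows as the pairs get closer. *)
have f_lip z : exists2 K : R, 0 < K & forall w w', chain_ball eps z w ->
    chain_ball eps z w' -> mdist (f w : R^o) (f w') <= K * mdist w w'.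
  have [[n nz]|nz] := pselect (exists n, chain_ball eps (x n) z).
    have d0 : 0 < mdist (x n) (y n) by rewrite mdist_gt0 split_pairs_neq.
    exists (mdist (x n) (y n))^-1; first by rewrite invr_gt0.
    have fE w : chain_ball eps z w -> f w = mdist (x n) w / mdist (x n) (y n).
      by move=> zw; apply: (fP w).1; exact: chain_ball_trans nz zw.
    move=> w w' /fE-> /fE->.
    rewrite mdist_regular -mulrBl normrM mulrC gtr0_norm ?invr_gt0//.
    rewrite ler_pM2l ?invr_gt0//.
    rewrite ler_norml; apply/andP; split; last by rewrite lerBlDl metric_triangle.
    by rewrite -opprB lerN2 lerBlDl (metric_sym w) metric_triangle.
  have f0 w : chain_ball eps z w -> f w = 0.
    move=> zw; apply: (fP w).2 => n nw; apply: nz; exists n.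
    exact: chain_ball_trans nw (chain_ball_sym zw).
  by exists 1 => // w w' /f0-> /f0->; rewrite mdistxx mul1r mdist_ge0.
exists f; split=> [z zC e e0|z|n|n].
(* A tail of the quasi-Cauchy sequence stays in the component of [p], where one constant [K]
   suffices. *)
- have [p [N _ pz]] := quasi_cauchy_bqc zC eps0; have [K K0 KP] := f_lip p.
  have [M _ MP] := zC _ (divr_gt0 e0 K0).
  exists (maxn N M) => // n /=; rewrite geq_max => /andP[Nn Mn].
  apply: le_lt_trans (KP _ _ (pz _ (leqW Nn)) (pz _ Nn)) _.
  by rewrite mulrC -ltr_pdivlMr//; exact: MP.
- apply/metricType_numDomainType.cvgrPdist_lt => e e0.
  have [K K0 KP] := f_lip z.
  (* Within distance [eps], [w] stays in the component of [z]: components are open. *)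
  have d0 : 0 < Num.min eps (e / K) by rewrite lt_min eps0 divr_gt0.
  apply/nbhs_ballP; exists (Num.min eps (e / K)) => //= w.
  rewrite ballEmdist /= lt_min => /andP[/chain_ball_step zw dzw].
  apply: le_lt_trans (KP _ _ (chain_ball_refl _ _) zw) _.
  by rewrite mulrC -ltr_pdivlMr.
- by rewrite ((fP _).1 n) ?mdistxx ?mul0r//; exact: chain_ball_refl.
- rewrite ((fP _).1 n) ?divff//; last exact: split_pairs_chain.
  by rewrite gt_eqF// mdist_gt0 split_pairs_neq.
Qed.

End theory.
End split_pairs.

(** * Condition (3) against the other conditions, beginning with its consequences *)

Section equivalences.
Context {R : realType} {X : metricType R}.
Implicit Types (A U : set X) (x y : nat -> X).

Local Notation accX := (limit_point [set: X]).
Local Notation small_isolation_bqc := (forall x : nat -> X,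
  isolation (x n) @[n --> \oo] --> 0%E -> has_bqc_subsequence x).

Lemma small_isolation_bqcPn : ~ small_isolation_bqc ->
  exists eps x y, @split_pairs R X eps x y.
Proof.
by move=> /existsNP[x /not_implyP[x0 xC]]; exact: split_pairs_exist xC.
Qed.

(** The neighbours [q n] make the isolation of [p n] tend to 0, so (3) and quasi-completeness give a
    limit in [A], which [q] shares. The [q n] range over [X] because isolation is measured there. *)
Lemma cvg_subseq_pairs A (p q : nat -> X) : small_isolation_bqc ->
  bourbaki_quasi_complete A -> (forall n, A (p n)) ->
  (forall n, p n != q n) -> (forall n, mdist (p n) (q n) < n.+1%:R^-1) ->
  exists2 a, A a & exists2 phi : nat -> nat, increasing_seq phi &
    forall e : R, 0 < e -> \forall n \near \oo,
      mdist a (p (phi n)) < e /\ mdist a (q (phi n)) < e.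
Proof.
move=> X3 AC Ap pq dpq.
have [phi phi_incr pC] := X3 _ (isolation_cvg0 pq dpq).
have [a Aa [psi psi_incr pa]] := AC (p \o phi) (fun n => Ap _) pC.
exists a => //; exists (phi \o psi); first exact: increasing_seq_comp.
move=> e e0; have e20 : 0 < e / 2 by rewrite divr_gt0.
have [M _ MP] := metricType_numDomainType.cvgr_dist_lt pa e20.
have [N Ne] := exists_invSn_lt e20.
exists (maxn M N) => // n /=; rewrite geq_max => /andP[Mn Nn].
have an := MP _ Mn; split.
  by apply: lt_trans an _; rewrite gtr_pMr// invf_lt1// ltr1n.
apply: le_lt_trans (metric_triangle _ (p (phi (psi n))) _) _.
rewrite [ltRHS]splitr ltrD//; apply: lt_trans (dpq _) (Ne _ _).
exact: leq_trans Nn (leq_increasing_seq _ (increasing_seq_comp phi_incr psi_incr)).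
Qed.

(** Otherwise accumulation points in distinct [eps]-chain components can be chosen one after
    another. Their isolation vanishes, yet no subsequence stays in one component. *)
Lemma small_isolation_precompact :
  small_isolation_bqc -> bourbaki_quasi_precompact accX.
Proof.
move=> X3 eps eps0; apply: contrapT => noF.
have [s|x xP] := @history_choice X
    (fun s t => accX t /\ forall r, r \in s -> ~ chain_ball eps r t).
  apply: contrapT => no_t; apply: noF; exists [set` s]; first exact: finite_seq.
  move=> t Xt; apply: contrapT => ts; apply: no_t; exists t; split=> // r rs rt.
  by apply: ts; exists r.
have x_sep m n : (m < n)%N -> ~ chain_ball eps (x m) (x n).
  move=> mn; apply: (xP n).2; apply: map_f.
  by rewrite mem_iota add0n mn.
have [|phi phi_incr /(_ _ eps0)[r [N _ NP]]] := X3 x.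
  apply/isolation_cvg0P => e e0; near=> n.
  exact: (limit_point_setTP _).1 (xP n).1 _ e0.
have : (phi N < phi N.+1)%O by have /increasing_seqP/(_ N) := phi_incr.
move=> /x_sep; apply; apply: chain_ball_trans (NP _ _) => /=; last exact: leqnSn.
by apply: chain_ball_sym; exact: (NP N (leqnn N)).
Unshelve. all: by end_near. Qed.

(** Otherwise close pairs starting in [U] converge to a point of [U]. That point is isolated in [X],
    so both members of some pair coincide with it. *)
Lemma small_isolation_inf U : small_isolation_bqc ->
  bourbaki_quasi_complete U -> U `&` accX = set0 ->
  (0 < ereal_inf [set isolation p | p in U])%E.
Proof.
move=> X3 UC UX; apply/(inf_isolation_gt0P U id); apply: contrapT => noe.
have /choice[pq pqP] (n : nat) : exists pq : X * X,
    [/\ U pq.1, pq.1 != pq.2 & mdist pq.1 pq.2 < n.+1%:R^-1].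
  apply: contrapT => no_pq; apply: noe.
  exists n.+1%:R^-1; first exact: invSn_gt0.
  move=> t q Ut qt; rewrite leNgt; apply/negP => tq.
  by apply: no_pq; exists (t, q); rewrite /= eq_sym.
have [|||a Ua [phi _ aP]] := @cvg_subseq_pairs U (fst \o pq) (snd \o pq) X3 UC.
- by move=> n; have [] := pqP n.
- by move=> n; have [] := pqP n.
- by move=> n; have [] := pqP n.
have : ~ accX a by move=> Xa; have : (U `&` accX) a by []; rewrite UX.
move=> /not_limit_point_setTP[e e0 ea]; have [N _ /(_ _ (leqnn N))] := aP _ e0.
move=> /= [/ea pa /ea qa]; have [_ + _] := pqP (phi N).
by rewrite pa qa eqxx.
Qed.

Lemma inf_isolation_uniformly_discrete U :
  (0 < ereal_inf [set isolation p | p in U])%E -> uniformly_discrete U.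
Proof.
move=> /(inf_isolation_gt0P U id)[e e0 eP]; exists e => // p q Up _ pq.
by apply: eP; rewrite // eq_sym.
Qed.

(** Finitely many isolated points have a common isolation radius, so a vanishing infimum is
    approached along a subsequence, to which (3) applies. *)
Lemma small_isolation_isolated x : small_isolation_bqc ->
  (forall n, isolated [set: X] (x n)) -> ~ has_bqc_subsequence x ->
  (0 < ereal_inf [set isolation (x n) | n in [set: nat]])%E.
Proof.
move=> X3 xiso xC; apply/inf_isolation_gt0P; apply: contrapT => noe.
have x_isolated N : exists2 e : R, 0 < e &
    forall n q, (n < N)%N -> mdist (x n) q < e -> q = x n.
  elim: N => [|N [e e0 eP]]; first by exists 1.
  have /isolated_setTP/not_limit_point_setTP[e' e'0 e'P] := xiso N.
  exists (Num.min e e'); first by rewrite lt_min e0.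
  move=> n q; rewrite ltnS leq_eqVlt lt_min => /orP[/eqP ->|nN] /andP[xe xe'].
    exact: e'P.
  exact: eP xe.
have [k N|phi phi_incr phiP] := @subsequence_choice (fun k n =>
    exists2 q, x n != q & mdist (x n) q < k.+1%:R^-1).
  (* By the choice of [e], an index whose point has a neighbour nearer than [e] must exceed [N]. *)
  have [e e0 eP] := x_isolated N.+1.
  apply: contrapT => no_m; apply: noe; exists (Num.min e k.+1%:R^-1).
    by rewrite lt_min e0 invSn_gt0.
  move=> n q _ qn; rewrite leNgt lt_min; apply/negP => /andP[xe xk].
  have [nN|Nn] := leqP n N; first by move/eqP: qn; apply; exact: eP xe.
  by apply: no_m; exists n => //; exists q; rewrite // eq_sym.
have /choice[q qP] (k : nat) : exists q,
    x (phi k) != q /\ mdist (x (phi k)) q < k.+1%:R^-1.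
  by have [q xq dxq] := phiP k; exists q.
apply: xC; apply: (has_bqc_subsequence_subseq phi_incr); apply: X3.
by apply: (@isolation_cvg0 _ _ _ q) => n; have [] := qP n.
Qed.

(** As in [small_isolation_inf], but with both members in [A], since discreteness separates the
    limit only from points of [A]. *)
Lemma small_isolation_discrete A : small_isolation_bqc ->
  discrete_subset A -> bourbaki_quasi_complete A -> uniformly_discrete A.
Proof.
move=> X3 /discrete_subsetP Adisc AC; apply: contrapT => noe.
have /choice[pq pqP] (n : nat) : exists pq : X * X,
    [/\ A pq.1, A pq.2, pq.1 != pq.2 & mdist pq.1 pq.2 < n.+1%:R^-1].
  apply: contrapT => no_pq; apply: noe.
  exists n.+1%:R^-1; first exact: invSn_gt0.
  move=> t q At Aq qt; rewrite leNgt; apply/negP => tq.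
  by apply: no_pq; exists (t, q).
have [|||a Aa [phi _ aP]] := @cvg_subseq_pairs A (fst \o pq) (snd \o pq) X3 AC.
- by move=> n; have [] := pqP n.
- by move=> n; have [] := pqP n.
- by move=> n; have [] := pqP n.
have [e e0 ea] := Adisc a Aa; have [N _ /(_ _ (leqnn N))] := aP _ e0.
have [Ap Aq + _] := pqP (phi N).
by move=> /[swap] /= -[/(ea _ Ap) -> /(ea _ Aq) ->]; rewrite eqxx.
Qed.

(** Close pairs on which [f] differs by at least [eps] are distinct, and they cluster at a point of
    [A], where continuity is contradicted. *)
Lemma small_isolation_UC A : small_isolation_bqc ->
  bourbaki_quasi_complete A -> UC_space (set_type A).
Proof.
move=> X3 AC f fcont; apply: contrapT.
move=> /not_unif_continuous_pairs[eps eps0 [p [q pqP]]].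
have [|||a Aa [phi _ aP]] :=
    @cvg_subseq_pairs A (set_val \o p) (set_val \o q) X3 AC.
- by move=> n; exact: set_valP.
- move=> n; apply: contraTneq (pqP n).2 => /val_inj ->.
  by rewrite mdistxx -ltNge.
- by move=> n; exact: (pqP n).1.
pose b : set_type A := exist _ a (mem_set Aa).
have e20 : 0 < eps / 2 by rewrite divr_gt0.
have /metricType_numDomainType.cvgrPdist_lt/(_ _ e20) := fcont b.
rewrite -nbhs_ballE => -[e /= e0 eP].
have [N _ /(_ _ (leqnn N))[/= pN qN]] := aP _ e0.
have := (pqP (phi N)).2; rewrite leNgt => /negP; apply.
have fp := eP (p (phi N)); have fq := eP (q (phi N)).
rewrite !ballEmdist in fp fq; rewrite [ltRHS]splitr.
apply: le_lt_trans (metric_triangle _ (f b) _) _; rewrite metric_sym ltrD//.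
  exact: fp.
exact: fq.
Qed.

Lemma small_isolation_ward (f : X -> R^o) : small_isolation_bqc ->
  ward_continuous f -> unif_continuous f.
Proof.
move=> X3 fW; apply: contrapT.
move=> /not_unif_continuous_pairs[eps eps0 [p [q pqP]]].
have [|phi phi_incr pC] := X3 p.
  apply: (@isolation_cvg0 _ _ _ q) => n; last exact: (pqP n).1.
  by apply: contraTneq (pqP n).2 => ->; rewrite mdistxx -ltNge.
have [n|n] :=
    @ward_continuous_pairs _ _ _ f (p \o phi) (q \o phi) eps fW eps0 pC.
  apply: lt_le_trans (pqP _).1 _.
  by rewrite lef_pV2 ?posrE ?ltr0n// ler_nat ltnS leq_increasing_seq.
by rewrite ltNge (pqP _).2.
Qed.

(** Arbitrarily late terms have another term nearby, a different point by injectivity, so isolation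
    tends to 0 along a subsequence. *)
Lemma small_isolation_pseudo_cauchy x : small_isolation_bqc ->
  injective x -> pseudo_cauchy x -> has_bqc_subsequence x.
Proof.
move=> X3 xinj xC.
have [k N|phi phi_incr phiP] := @subsequence_choice (fun k n =>
    exists q, x n != q /\ mdist (x n) q < k.+1%:R^-1).
  have [i [j [ij Ni _ xij]]] := xC _ N (invSn_gt0 R k).
  by exists i => //; exists (x j); rewrite (inj_eq xinj).
have /choice[q qP] := phiP.
apply: (has_bqc_subsequence_subseq phi_incr); apply: X3.
by apply: (@isolation_cvg0 _ _ _ q) => n; have [] := qP n.
Qed.

(** * From the other conditions back to (3), by means of split pairs *)

Lemma ward_small_isolation :
  (forall f : X -> R^o, ward_continuous f -> unif_continuous f) ->
  small_isolation_bqc.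
Proof.
move=> X1; apply: contrapT => /small_isolation_bqcPn[eps [x [y sxy]]].
have [f [fW _ fx fy]] := split_pairs_function sxy.
have /unif_continuous_mdistP/(_ _ ltr01)[d d0 dP] := X1 f fW.
have [N /(_ _ (leqnn _)) Nd] := exists_invSn_lt d0.
have := dP _ _ (lt_trans (split_pairs_mdist sxy N) Nd).
by rewrite mdist_regular fx fy subr0 normr1 ltxx.
Qed.

Lemma pseudo_cauchy_small_isolation :
  (forall x, injective x -> pseudo_cauchy x -> has_bqc_subsequence x) ->
  small_isolation_bqc.
Proof.
move=> X2; apply: contrapT => /small_isolation_bqcPn[eps [x [y sxy]]].
(* [z] interleaves the pairs, so each pair becomes two consecutive terms. *)
pose z n := if odd n then y n./2 else x n./2.
have zP n : z n = x n./2 \/ z n = y n./2 by rewrite /z; case: odd; [right|left].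
have z_chain n : chain_ball eps (x n./2) (z n).
  case: (zP n) => ->; [exact: chain_ball_refl|exact: split_pairs_chain sxy _].
have z_inj : injective z.
  move=> m n zmn; have mn2 : m./2 = n./2.
    apply: (split_pairs_inj sxy); apply: chain_ball_trans (z_chain m) _.
    by rewrite zmn; apply: chain_ball_sym; exact: z_chain.
  rewrite -(odd_double_half m) -(odd_double_half n) mn2; congr (_ + _)%N.
  have := split_pairs_neq sxy n./2; move: zmn; rewrite /z mn2.
  by case: odd; case: odd => // ->; rewrite eqxx.
have [|phi phi_incr zC] := X2 z z_inj.
  (* [n.+1] takes both positions of pair [M] past [n], and [N] makes the pair [e]-close. *)
  move=> e n /exists_invSn_lt[N Ne]; pose M := maxn n.+1 N.
  have nM : (n < M.*2)%N.
    by rewrite -addnn; apply: leq_trans (leq_addr _ _); exact: leq_maxl.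
  exists M.*2, M.*2.+1; split=> //; first by rewrite neq_ltn leqnn.
    exact: leqW.
  rewrite /z /= odd_double /= uphalf_double doubleK.
  apply: lt_trans (split_pairs_mdist sxy M) (Ne _ _); exact: leq_maxr.
have [K [N _ NP]] := split_pairs_bqc sxy (fun n => zP (phi n)) zC.
(* Half of an index from [K.+1.*2] on exceeds [K], while along the subsequence it should eventually
   equal [K]. *)
have := NP (maxn N K.+1.*2) (leq_maxl _ _) => /= phiK.
have := leq_trans (leq_maxr N K.+1.*2) (leq_increasing_seq _ phi_incr).
by move=> /half_leq; rewrite phiK doubleK ltnn.
Qed.

(** The component of each of the finitely many centres covering [A] contains at most one pair; a
    shift discards these pairs. *)
Lemma split_pairs_avoid A eps x y :
  bourbaki_quasi_precompact A -> split_pairs eps x y ->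
  exists x' y', split_pairs eps x' y' /\ (forall n, ~ A (x' n) /\ ~ A (y' n)).
Proof.
move=> AC sxy; have eps0 : 0 < eps by case: sxy.
have [_ /finite_seqP[s ->] As] := AC _ eps0.
have [N NP] : exists N, forall n r, (N <= n)%N -> r \in s ->
    ~ chain_ball eps r (x n).
  elim: s {As} => [|r s [N NP]]; first by exists 0%N.
  have [[k rk]|rx] := pselect (exists k, chain_ball eps r (x k)); last first.
    exists N => n r' Nn; rewrite inE => /orP[/eqP-> rn|]; last exact: NP.
    by apply: rx; exists n.
  exists (maxn N k.+1) => n r'; rewrite geq_max => /andP[Nn kn].
  rewrite inE => /orP[/eqP-> rn|]; last exact: NP.
  have := split_pairs_inj sxy (chain_ball_trans (chain_ball_sym rk) rn).
  by move=> nk; rewrite nk ltnn in kn.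
exists (fun n => x (N + n)%N), (fun n => y (N + n)%N).
split=> [|n]; first exact: split_pairs_shift.
split=> /As[r /= rs rz]; apply: (NP _ _ (leq_addr n N) rs) => //.
by apply: chain_ball_trans rz (chain_ball_sym _); exact: split_pairs_chain sxy _.
Qed.

Lemma uniformly_discrete_small_isolation :
  bourbaki_quasi_precompact accX ->
  (forall U, infinite_set U -> bourbaki_quasi_complete U ->
    U `&` accX = set0 -> uniformly_discrete U) ->
  small_isolation_bqc.
Proof.
move=> X'C X4; apply: contrapT => /small_isolation_bqcPn[eps [x [y sxy]]].
have [x' [y' [{}sxy xyX]]] := split_pairs_avoid X'C sxy.
apply: (pair_set_not_uniformly_discrete sxy); apply: X4.
- exact: pair_set_infinite sxy.
- exact: pair_set_bqc sxy.
- rewrite -subset0 => _ [[n [->|->]]]; by have [] := xyX n.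
Qed.

Lemma isolated_small_isolation :
  bourbaki_quasi_precompact accX ->
  (forall x, (forall n, isolated [set: X] (x n)) -> ~ has_bqc_subsequence x ->
    (0 < ereal_inf [set isolation (x n) | n in [set: nat]])%E) ->
  small_isolation_bqc.
Proof.
move=> X'C X6; apply: contrapT => /small_isolation_bqcPn[eps [x [y sxy]]].
have [x' [y' [{}sxy xyX]]] := split_pairs_avoid X'C sxy.
have x'_iso n : isolated [set: X] (x' n).
  by apply/isolated_setTP; have [] := xyX n.
have /inf_isolation_gt0P[e e0 eP] := X6 x' x'_iso (split_pairs_no_bqc sxy).
have [N /(_ _ (leqnn _)) Ne] := exists_invSn_lt e0.
have := eP N (y' N) I; rewrite eq_sym (split_pairs_neq sxy) => /(_ isT).
by rewrite leNgt (lt_trans (split_pairs_mdist sxy N)).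
Qed.

Lemma discrete_small_isolation :
  (forall A, discrete_subset A -> bourbaki_quasi_complete A ->
    uniformly_discrete A) ->
  small_isolation_bqc.
Proof.
move=> X7; apply: contrapT => /small_isolation_bqcPn[eps [x [y sxy]]].
apply: (pair_set_not_uniformly_discrete sxy); apply: X7.
- exact: pair_set_discrete sxy.
- exact: pair_set_bqc sxy.
Qed.

Lemma UC_small_isolation :
  (forall A, bourbaki_quasi_complete A -> UC_space (set_type A)) ->
  small_isolation_bqc.
Proof.
move=> X8; apply: contrapT => /small_isolation_bqcPn[eps [x [y sxy]]].
have [f [_ fcont fx fy]] := split_pairs_function sxy.
have := X8 _ (pair_set_bqc sxy); set A := (X in UC_space X) => AUC.
have /AUC/unif_continuous_mdistP/(_ _ ltr01)[d d0 dP] :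
    continuous (f \o set_val : A -> R^o).
  by move=> a; apply: continuous_comp; [exact: initial_continuous|exact: fcont].
have [N /(_ _ (leqnn _)) Nd] := exists_invSn_lt d0.
have := dP (exist _ (x N) (mem_set (pair_setl x y N)))
  (exist _ (y N) (mem_set (pair_setr x y N)))
  (lt_trans (split_pairs_mdist sxy N) Nd).
by rewrite mdist_regular /= /set_val/= fx fy subr0 normr1 ltxx.
Qed.

End equivalences.

Theorem theorem3p6 (R : realType) (X : metricType R) :
  let X' : set X := limit_point [set: X] in
  [<->
    (* 1 *)
    forall f : X -> R^o, ward_continuous f -> unif_continuous f;
    (* 2 *)
    forall x : nat -> X, injective x -> pseudo_cauchy x ->
      has_bqc_subsequence x;
    (* 3 *)
    forall x : nat -> X, isolation (x n) @[n --> \oo] --> 0%E ->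
      has_bqc_subsequence x;
    (* 4 *)
    bourbaki_quasi_precompact X' /\
      forall U : set X, infinite_set U -> bourbaki_quasi_complete U ->
        U `&` X' = set0 -> uniformly_discrete U;
    (* 5 *)
    bourbaki_quasi_precompact X' /\
      forall U : set X, infinite_set U -> bourbaki_quasi_complete U ->
        U `&` X' = set0 -> (0 < ereal_inf [set isolation p | p in U])%E;
    (* 6 *)
    bourbaki_quasi_precompact X' /\
      forall x : nat -> X, (forall n, isolated [set: X] (x n)) ->
        ~ has_bqc_subsequence x -> (0 < ereal_inf [set isolation (x n) | n in [set: nat]])%E;
    (* 7 *)
    forall A : set X, discrete_subset A -> bourbaki_quasi_complete A ->
      uniformly_discrete A;
    (* 8 *)
    forall A : set X, bourbaki_quasi_complete A -> UC_space (set_type A)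
  ].
Proof.
(* The cycle of implications is closed by recovering (3) from each other condition and then deriving
   the next one. *)
move=> X'; tfae.
- move=> X1 x xinj; apply: small_isolation_pseudo_cauchy => //.
  exact: ward_small_isolation.
- exact: pseudo_cauchy_small_isolation.
- move=> X3; split=> [|U _ UC UX]; first exact: small_isolation_precompact.
  exact/inf_isolation_uniformly_discrete/small_isolation_inf.
- move=> [X'C X4]; split=> // U _; apply: small_isolation_inf.
  exact: uniformly_discrete_small_isolation.
- move=> [X'C X5]; split=> // x; apply: small_isolation_isolated.
  (* (5) gives (3) by way of (4). *)
  apply: uniformly_discrete_small_isolation => // U Uoo UC UX.
  by apply: inf_isolation_uniformly_discrete; exact: X5.
- move=> [X'C X6] A; apply: small_isolation_discrete.
  exact: isolated_small_isolation.
- by move=> X7 A; apply: small_isolation_UC; exact: discrete_small_isolation.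
- by move=> X8 f; apply: small_isolation_ward; exact: UC_small_isolation.
Qed.
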